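(* Let $\mathbf u\in\mathcal A^{\mathbb N}$ be a uniformly recurrent infinite word with finite defect. Then there exist a finite alphabet $\mathcal B$, a rich infinite word $\mathbf v\in\mathcal B^{\mathbb N}$ and a morphism $\varphi:\mathcal B^*\to\mathcal A^*$ of class $P_{ret}$ such that $\mathbf u=\varphi(\mathbf v)$. Moreover, $\mathbf v$ is uniformly recurrent.
   Context: For a finite word $w$, $\overline{w}$ denotes its reversal; $w$ is a palindrome if $w=\overline w$. The defect of a finite word $w$ is $D(w)=|w|+1-(\text{number of distinct palindromic factors of } w, \text{ including the empty word})$; the defect of an infinite word $\mathbf u$ is $D(\mathbf u)=\sup\{D(w): w \text{ a prefix of }\mathbf u\}$. An infinite word is rich if its defect is $0$, i.e., every prefix of length $n$ contains exactly $n+1$ distinct palindromes. An infinite word is uniformly recurrent if every factor occurs infinitely often with bounded gaps between consecutive occurrences. A morphism $\varphi:\mathcal B^*\to\mathcal A^*$ is of class $P_{ret}$ if there exists a palindrome $p\in\mathcal A^*$ such that: (a) $\varphi(b)p$ is a palindrome for every $b\in\mathcal B$; (b) for every $b\in\mathcal B$, $\varphi(b)p$ contains exactly two occurrences of $p$, one as a prefix and one as a suffix; (c) $\varphi(b)\ne\varphi(c)$ for distinct $b,c\in\mathcal B$. For $\mathbf v=v_0v_1\cdots$, $\varphi(\mathbf v)=\varphi(v_0)\varphi(v_1)\cdots$. *)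

(* Defs.v *)
From mathcomp Require Import all_boot.
Set Implicit Arguments. Unset Strict Implicit. Unset Printing Implicit Defensive.

Section Words.
Variable A : finType.

Definition palindrome (w : seq A) : bool := rev w == w.

Definition factors (w : seq A) : seq (seq A) :=
  [seq take j (drop i w) | i <- iota 0 (size w).+1, j <- iota 0 (size w).+1].

Definition num_pal (w : seq A) : nat := size (undup [seq x <- factors w | palindrome x]).

Definition defect (w : seq A) : nat := (size w).+1 - num_pal w.

Definition wfactor (u : nat -> A) (i n : nat) : seq A := mkseq (fun k => u (i + k)) n.

Definition wprefix (u : nat -> A) (n : nat) : seq A := wfactor u 0 n.

Definition finite_defect (u : nat -> A) : Prop :=
  exists K, forall n, defect (wprefix u n) <= K.

Definition rich (u : nat -> A) : Prop :=
  forall n, num_pal (wprefix u n) = n.+1.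

Definition occurs_at (u : nat -> A) (w : seq A) (i : nat) : bool :=
  wfactor u i (size w) == w.

Definition is_factor (u : nat -> A) (w : seq A) : Prop := exists i, occurs_at u w i.

Definition uniformly_recurrent (u : nat -> A) : Prop :=
  forall w, is_factor u w ->
    exists R, forall j, exists2 k, j <= k <= j + R & occurs_at u w k.
End Words.

Section Morphisms.
Variables (B A : finType).

Definition occ_count (p w : seq A) : nat :=
  count (fun i => take (size p) (drop i w) == p) (iota 0 (size w - size p).+1).

(* the morphism phi : B^* -> A^* is given by the images of letters *)
Definition class_Pret (phi : B -> seq A) : Prop :=
  exists p : seq A, palindrome p /\
    (forall b, palindrome (phi b ++ p)) /\
    (forall b, [/\ prefix p (phi b ++ p), suffix p (phi b ++ p)
                 & occ_count p (phi b ++ p) = 2]) /\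
    injective phi.

(* u = phi(v) = phi(v_0) phi(v_1) ... : every phi(v_0 ... v_{m-1}) is a prefix
   of u, and these prefixes have unbounded length *)
Definition morph_image (phi : B -> seq A) (v : nat -> B) (u : nat -> A) : Prop :=
  (forall m, let s := flatten (map phi (wprefix v m)) in wprefix u (size s) = s) /\
  (forall n, exists m, n < size (flatten (map phi (wprefix v m)))).
End Morphisms.

(* Main.v *)
Require Import Defs.
From mathcomp Require Import all_boot.
From mathcomp Require Import zify.
From Stdlib Require Import Classical.
Set Implicit Arguments. Unset Strict Implicit. Unset Printing Implicit Defensive.

(** Finite defect means that every sufficiently long prefix of [u] ends in a
palindrome with no earlier occurrence in [u].  Such a palindrome is longer than
any suffix of that prefix which occurs earlier, itself or reversed.  Applied at the
next occurrence of a prefix [w] or of its reversal, this makes [u] have long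
palindromic prefixes; applied at the first occurrence of a complete return word
(or of its reversal) to a long palindrome, it makes complete returns palindromic.
Cut [u] at the occurrences of a long palindromic prefix [p]; the blocks are the
letters of [v].  The new palindromic suffix of the prefix of [u] ending with the
[n]-th occurrence of [p] starts with [p], so it is [phi(x)p] for a suffix [x] of
[v_0 ... v_(n-1)], and [x] is a palindrome that has no earlier occurrence in [v]:
hence [v] is rich. *)

(* The shorter of two palindromic suffixes is also a prefix of the longer one. *)
Lemma suffix_palindrome_infix (T : eqType) (w : seq T) (a : T) (x y : seq T) :
  rev x = x -> rev y = y -> suffix x (rcons w a) -> suffix y (rcons w a) ->
  size x < size y -> infix x w.
Proof.
move=> px py /suffixP[s es] /suffixP[s' es'] sxy.
have /prefixP[z ez] : prefix x y.
  rewrite -px -py prefix_rev suffixE; apply/eqP.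
  have e : s' ++ y = s ++ x by rewrite -es.
  have /(congr1 size) := e; rewrite !size_cat => ez.
  have := congr1 (drop (size s)) e; rewrite (drop_size_cat x (erefl (size s))) drop_cat => <-.
  have ss : size s' < size s by lia.
  by rewrite ltnNge (ltnW ss) /= size_drop; congr drop; lia.
case/lastP: z ez es' => [|z b] ez; first by move: sxy; rewrite ez cats0 ltnn.
rewrite ez -rcons_cat -rcons_cat => /rcons_inj[-> _].
exact: infix_infix.
Qed.

(** * Palindromes gained when a letter is appended *)

Section PalindromeCount.
Variable A : finType.
Implicit Types (w x y : seq A) (u : nat -> A).

Lemma palindromeP w : reflect (rev w = w) (palindrome w).
Proof. exact: eqP. Qed.

Lemma mem_factors x w : (x \in factors w) = infix x w.
Proof.
apply/allpairsP/infixP => [[[i j] /= [_ _ ->]]|[s [s' ->]]].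
  exists (take i w), (drop j (drop i w)).
  by rewrite !cat_take_drop.
exists (size s, size x); split.
- by rewrite mem_iota !size_cat /=; lia.
- by rewrite mem_iota !size_cat /=; lia.
- by rewrite /= drop_size_cat // take_size_cat.
Qed.

Definition pals w := undup [seq x <- factors w | palindrome x].

Lemma mem_pals x w : (x \in pals w) = palindrome x && infix x w.
Proof. by rewrite mem_undup mem_filter mem_factors. Qed.

Lemma num_pal_nil : num_pal (@nil A) = 1.
Proof. by []. Qed.

(** A palindrome absent from [w] must be a suffix of [rcons w a]. Of two such suffixes, the shorter
    would already be an infix of [w] by [suffix_palindrome_infix], so at most one is gained. *)
Lemma num_pal_rcons_le w a : num_pal (rcons w a) <= (num_pal w).+1.
Proof.
have sub z : z \in pals (rcons w a) -> (z \in pals w) || (palindrome z && suffix z (rcons w a) && ~~ infix z w).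
  rewrite !mem_pals infix_rconsl => /andP[-> /=].
  by case: (infix z w); rewrite ?orbF ?andbT // => ->.
case: (boolP (has (fun z => z \notin pals w) (pals (rcons w a)))) => [/hasP[z zin zout]|/hasPn h].
  apply: (@uniq_leq_size _ (pals (rcons w a)) (z :: pals w)); first exact: undup_uniq.
  move=> y yin; rewrite inE.
  move: (sub _ zin) (sub _ yin); rewrite (negPf zout) /=.
  case/andP=> /andP[pz sz] iz /orP[-> |/andP[/andP[py sy] iy]]; first by rewrite orbT.
  apply/orP; left; apply/eqP.
  have [ls|ls|es] := ltngtP (size y) (size z).
  - by rewrite (suffix_palindrome_infix (eqP py) (eqP pz) sy sz ls) in iy.
  - by rewrite (suffix_palindrome_infix (eqP pz) (eqP py) sz sy ls) in iz.
  - by move: sy sz; rewrite !suffixE es => /eqP ey /eqP ez; rewrite -{1}ey -[RHS]ez.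
apply: leqW; apply: uniq_leq_size; first exact: undup_uniq.
by move=> y /h; rewrite negbK.
Qed.

Lemma num_pal_rconsP w a :
  reflect (exists2 x, palindrome x & suffix x (rcons w a) /\ ~~ infix x w)
    (num_pal w < num_pal (rcons w a)).
Proof.
apply: (iffP idP) => [lt|[x px [sx ix]]].
  have /hasP[x] : has (fun z => z \notin pals w) (pals (rcons w a)).
    apply: contraLR lt => /hasPn h; rewrite -leqNgt.
    by apply: uniq_leq_size; [exact: undup_uniq | move=> y /h; rewrite negbK].
  rewrite !mem_pals infix_rconsl => /andP[px] /orP[sx|->]; rewrite px //= => nx.
  by exists x.
apply: (@uniq_leq_size _ (x :: pals w) (pals (rcons w a))).
  by rewrite /= undup_uniq mem_pals (negPf ix) andbF.
move=> y; rewrite inE !mem_pals => /predU1P[->|/andP[-> iy]].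
  by rewrite px infix_rconsl sx.
by rewrite infix_rconsl iy orbT.
Qed.

End PalindromeCount.

(** * Factors of an infinite word and its new palindromic suffixes *)

Section Factors.
Variables (A : finType) (u : nat -> A).

Lemma size_wfactor i n : size (wfactor u i n) = n.
Proof. exact: size_mkseq. Qed.

Lemma wfactor_cat i m n : wfactor u i (m + n) = wfactor u i m ++ wfactor u (i + m) n.
Proof.
rewrite /wfactor /mkseq iotaD map_cat; congr (_ ++ _).
rewrite add0n -[m]addn0 iotaDl -map_comp.
by apply: eq_map => k /=; rewrite addn0 addnA.
Qed.

Lemma wfactorS i n : wfactor u i n.+1 = rcons (wfactor u i n) (u (i + n)).
Proof. by rewrite /wfactor mkseqS. Qed.

Lemma wfactor_catl i m x y : wfactor u i m = x ++ y -> wfactor u i (size x) = x.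
Proof.
move=> e; have := congr1 size e; rewrite size_wfactor size_cat => em.
by move: e; rewrite em wfactor_cat => /eqP; rewrite eqseq_cat ?size_wfactor // => /andP[/eqP].
Qed.

Lemma wfactor_catr i m x y :
  wfactor u i m = x ++ y -> wfactor u (i + size x) (size y) = y.
Proof.
move=> e; have := congr1 size e; rewrite size_wfactor size_cat => em.
by move: e; rewrite em wfactor_cat => /eqP; rewrite eqseq_cat ?size_wfactor // => /andP[_ /eqP].
Qed.

Lemma wfactor_sub a b m d l : wfactor u a m = wfactor u b m -> d + l <= m ->
  wfactor u (a + d) l = wfactor u (b + d) l.
Proof.
move=> e /subnKC em; move: e; rewrite -em !wfactor_cat => /eqP.
by rewrite !eqseq_cat ?size_cat ?size_wfactor // => /andP[/andP[_ /eqP]].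
Qed.

(** Reversing a window swaps the margins [d] and [e] on the two sides of a subwindow. *)
Lemma wfactor_rev_sub a b m d e l : wfactor u a m = rev (wfactor u b m) ->
  d + l + e = m -> wfactor u (a + d) l = rev (wfactor u (b + e) l).
Proof.
move=> eab em; move: eab; have em' : e + l + d = m by rewrite -em; lia.
rewrite -{1}em -em' !wfactor_cat !rev_cat [rev _ ++ _]catA => /eqP.
rewrite !eqseq_cat ?size_cat ?size_rev ?size_wfactor //.
by case/andP=> /andP[_ /eqP].
Qed.

Lemma occurs_atE w i : occurs_at u w i = (wfactor u i (size w) == w).
Proof. by []. Qed.

Lemma infix_wprefixP x n :
  reflect (exists2 k, k + size x <= n & occurs_at u x k) (infix x (wprefix u n)).
Proof.
apply: (iffP (@infixP A _ _)) => [[s [s' e]]|[k kn ox]].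
  exists (size s).
    by have /(congr1 size) := e; rewrite !size_cat size_wfactor /=; lia.
  by apply/eqP; have /wfactor_catl := wfactor_catr e.
exists (wprefix u k), (wfactor u (k + size x) (n - (k + size x))).
rewrite -[in RHS](eqP ox) size_wfactor catA -(wfactor_cat 0) -(wfactor_cat 0).
by rewrite subnKC.
Qed.

(* The palindrome below is nonempty when [n > 0]: the empty suffix [k = n]
already occurs at [0]. *)
Definition new_pal n := exists k, [/\ k <= n, palindrome (wfactor u k (n - k)) &
  forall j, j < k -> wfactor u j (n - k) <> wfactor u k (n - k)].

Lemma num_pal_wprefixP n :
  num_pal (wprefix u n) < num_pal (wprefix u n.+1) <-> new_pal n.+1.
Proof.
rewrite /wprefix wfactorS; split.
  case/num_pal_rconsP => x px [/suffixP[s]]; rewrite -wfactorS => e nx.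
  have ex := wfactor_catr e.
  have en : n.+1 = size s + size x by rewrite -size_cat -e size_wfactor.
  exists (size s); rewrite en leq_addr addKn ex; split=> // j jk ej.
  case/infix_wprefixP: nx; exists j; last by apply/eqP.
  by rewrite -ltnS en ltn_add2r.
case=> k [kn pk uk]; apply/num_pal_rconsP; exists (wfactor u k (n.+1 - k)) => //.
rewrite -wfactorS; split.
  apply/suffixP; exists (wfactor u 0 k).
  by rewrite -{1}(subnKC kn) wfactor_cat.
apply/infix_wprefixP => -[j]; rewrite size_wfactor => jk.
rewrite occurs_atE size_wfactor => /eqP; apply: uk; lia.
Qed.

Lemma num_pal_wprefix_le n : num_pal (wprefix u n) <= n.+1.
Proof.
elim: n => [|n IH]; first by rewrite num_pal_nil.
rewrite /wprefix wfactorS; exact: leq_trans (num_pal_rcons_le _ _) _.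
Qed.

Lemma new_pal_rich : (forall n, 0 < n -> new_pal n) -> rich u.
Proof.
move=> h; elim=> [|n IH]; first exact: num_pal_nil.
apply/eqP; rewrite eqn_leq num_pal_wprefix_le -[in X in _ && (X < _)]IH.
by apply/num_pal_wprefixP; apply: h.
Qed.

Lemma defect_wprefixS n : defect (wprefix u n) <= defect (wprefix u n.+1).
Proof.
rewrite /defect !size_wfactor /wprefix wfactorS.
have := num_pal_rcons_le (wfactor u 0 n) (u (0 + n)); lia.
Qed.

(** The defect never decreases along prefixes, so a bounded defect is eventually constant, and while
    it is constant each letter brings a new palindrome. The induction lowers the bound [K] until it
    is attained. *)
Lemma finite_defect_new_pal :
  finite_defect u -> exists2 N, 0 < N & forall n, N <= n -> new_pal n.
Proof.
case=> K; elim: K => [|K IH] hK.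
  exists 1 => // -[//|n] _; apply/num_pal_wprefixP.
  move: (hK n) (hK n.+1) (num_pal_wprefix_le n) (num_pal_wprefix_le n.+1).
  by rewrite /defect !size_wfactor; lia.
have [[n en]|no] := classic (exists n, defect (wprefix u n) = K.+1).
  have hm m : n <= m -> defect (wprefix u m) = K.+1.
    elim: m => [|m IHm]; first by rewrite leqn0 => /eqP <-.
    rewrite leq_eqVlt => /predU1P[<- //|/IHm e].
    by apply/eqP; rewrite eqn_leq hK -e defect_wprefixS.
  exists n.+1 => // -[//|m] nm; apply/num_pal_wprefixP.
  move: (hm m nm) (hm m.+1 (leqW nm)).
  by rewrite /defect !size_wfactor; lia.
apply: IH => n; rewrite -ltnS ltn_neqAle hK andbT.
by apply/eqP => e; apply: no; exists n.
Qed.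

(** If [k <= k'], the palindrome lies inside the factor starting at [k]. The copy of that factor at
    [i], reversed or not, contains the same palindrome, which would then occur before [k']. *)
Lemma new_pal_extend n i k : new_pal n -> i < k <= n ->
  wfactor u i (n - k) = wfactor u k (n - k) \/
  wfactor u i (n - k) = rev (wfactor u k (n - k)) ->
  exists k', [/\ k' < k, palindrome (wfactor u k' (n - k')) &
    forall j, j < k' -> wfactor u j (n - k') <> wfactor u k' (n - k')].
Proof.
move=> [k' [k'n pk' uk']] /andP[ik kn] hw; exists k'; split=> //.
rewrite ltnNge; apply/negP => kk'; case: hw => e.
  apply: (uk' (i + (k' - k))); first by lia.
  by rewrite (wfactor_sub e) ?subnKC //; lia.
(* Reversal turns a palindromic suffix of the factor into a prefix, so the palindrome reappears at
   [i] itself. *)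
apply: (uk' i); first by lia.
have := wfactor_rev_sub (d := 0) (e := k' - k) (l := n - k') e.
rewrite addn0 subnKC // (palindromeP _ pk'); apply; lia.
Qed.

Lemma palindrome_wfactor_rev k' k n :
  palindrome (wfactor u k' (n - k')) -> k' <= k <= n ->
  wfactor u k' (n - k) = rev (wfactor u k (n - k)).
Proof.
move=> /palindromeP /esym e /andP[k'k kn].
have := wfactor_rev_sub (d := 0) (e := k - k') (l := n - k) e.
rewrite addn0 subnKC //; apply; lia.
Qed.

Lemma long_palindromic_prefix N : uniformly_recurrent u ->
  (forall n, N <= n -> new_pal n) -> exists2 n, N <= n & palindrome (wprefix u n).
Proof.
move=> ur hN; set w := wprefix u N.
pose P k := (0 < k) && ((wfactor u k N == w) || (wfactor u k N == rev w)).
have exP : exists k, P k.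
  have [|R /(_ 1)[k /andP[k0 _]]] := ur w.
    by exists 0; rewrite occurs_atE size_wfactor.
  by rewrite occurs_atE size_wfactor => e; exists k; rewrite /P k0 e.
case: (ex_minnP exP) => k /andP[k0 hk] mk.
exists (k + N); first exact: leq_addl.
have [||k' [k'k pk' _]] := @new_pal_extend (k + N) 0 k (hN _ (leq_addl _ _)).
- by rewrite k0 leq_addr.
- by rewrite addKn; case/orP: hk => /eqP ->; rewrite ?revK; [left|right].
(* Reflection in the palindrome starting at [k'] carries the factor at [k] to [k'], so [w] or
   [rev w] occurs at [k' < k]. Minimality of [k] leaves only [k' = 0]: the whole prefix is a
   palindrome. *)
have rk' := palindrome_wfactor_rev pk' (n := k + N) (k := k).
rewrite (ltnW k'k) leq_addr addKn in rk'.
suff k'0 : k' = 0 by move: pk'; rewrite k'0 subn0.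
apply: contraTeq k'k => k'0; rewrite -leqNgt; apply: mk; rewrite /P lt0n k'0 /= rk' //.
by case/orP: hk => /eqP ->; rewrite ?revK eqxx ?orbT.
Qed.

Lemma prefix_wfactor p i m d : d + size p <= m ->
  prefix p (drop d (wfactor u i m)) = occurs_at u p (i + d).
Proof.
move=> dm; rewrite prefixE occurs_atE -(subnKC dm) -addnA wfactor_cat.
by rewrite drop_size_cat ?size_wfactor // wfactor_cat take_size_cat ?size_wfactor.
Qed.

Lemma wfactor_return p i j : i < j -> occurs_at u p j ->
  wfactor u i (j - i + size p) = wfactor u i (j - i) ++ p.
Proof. by move=> ij /eqP oj; rewrite wfactor_cat subnKC ?oj // ltnW. Qed.

(** Take the first copy of the return or of its reversal, and the new palindrome ending where this
    copy ends. If the palindrome started inside the copy, reflection would put [p] strictly inside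
    the return; if it started before, reflection would give an earlier copy. So it is the copy
    itself. *)
Lemma palindromic_return N p i j : (forall n, N <= n -> new_pal n) ->
  N <= size p -> palindrome p -> i < j -> occurs_at u p i -> occurs_at u p j ->
  (forall k, i < k < j -> ~~ occurs_at u p k) ->
  palindrome (wfactor u i (j - i + size p)).
Proof.
move=> hN Np /palindromeP pp ij oi oj gap.
set d := j - i; set m := d + size p; set r := wfactor u i m.
(* Admitting [rev r] lets minimality apply to the mirror images produced below. *)
pose P k := (wfactor u k m == r) || (wfactor u k m == rev r).
have exP : exists k, P k by exists i; rewrite /P eqxx.
have d0 : 0 < d by rewrite subn_gt0.
have er : r = wfactor u i d ++ p by rewrite -wfactor_return.
have oir e : e <= d -> wfactor u (i + e) (size p) = p -> (e == 0) || (e == d).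
  move=> ed oe; have := gap (i + e); rewrite occurs_atE oe eqxx; lia.
(* In a reversed copy the offset [e] corresponds to [d - e] in [r], because [p] is a palindrome. *)
have oP k e : P k -> e <= d -> wfactor u (k + e) (size p) = p ->
    (e == 0) || (e == d).
  case/orP=> /eqP ek ed oe; first by apply: oir; rewrite // -(wfactor_sub ek) // /m; lia.
  suff : (d - e == 0) || (d - e == d) by lia.
  apply: oir; first exact: leq_subr.
  apply: (can_inj revK); rewrite -(wfactor_rev_sub (d := e) ek) /m ?oe ?pp //; lia.
case: (ex_minnP exP) => i' hi' mi'.
have [oi' oj'] : wfactor u i' (size p) = p /\ wfactor u (i' + d) (size p) = p.
  case/orP: (hi') => /eqP ei.
    have e0 := wfactor_sub (d := 0) (l := size p) ei.
    have ed := wfactor_sub (d := d) (l := size p) ei.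
    rewrite !addn0 in e0; rewrite e0 ?ed ?subnKC ?(eqP oi) ?(eqP oj) // /m; lia.
  have e0 := wfactor_rev_sub (d := 0) (l := size p) (e := d) ei.
  have ed := wfactor_rev_sub (d := d) (l := size p) (e := 0) ei.
  rewrite !addn0 in e0 ed; rewrite e0 ?ed ?subnKC ?(eqP oi) ?(eqP oj) ?pp // /m; lia.
have hn : N <= i' + d + size p by lia.
have [||k' [k'j pk' _]] := @new_pal_extend _ i' (i' + d) (hN _ hn).
- by lia.
- by left; rewrite addKn oi' oj'.
have rp := palindrome_wfactor_rev pk' (n := i' + d + size p).
have k'i : k' = i'.
  apply/eqP; rewrite eqn_leq; apply/andP; split.
    rewrite leqNgt; apply/negP => i'k'.
    have := oP i' (k' - i') hi'; rewrite subnKC ?(ltnW i'k') //.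
    have := rp (i' + d); rewrite addKn oj' pp => ->; last by lia.
    by move=> /(_ _ erefl); lia.
  have [//|k'i] := leqP i' k'.
  suff /mi' : P k' by rewrite leqNgt k'i.
  rewrite /P.
  have := rp i'; rewrite -addnA addKn -/m => ->; last by lia.
  by case/orP: hi' => /eqP ->; rewrite ?revK eqxx ?orbT.
move: pk'; rewrite k'i -addnA addKn -/m => /palindromeP pk'.
by apply/palindromeP; case/orP: hi' => /eqP ei; move: pk'; rewrite ei ?revK.
Qed.

End Factors.

(** * First returns to [p] and unique decoding *)

Section FirstReturns.
Variables (A : finType) (p : seq A).

(** Here [x ++ p] is a palindromic complete return to [p]; the occurrence at offset [size x] is
    automatic. Being boolean, the condition can carve the alphabet of blocks out of a finite
    type. *)
Definition first_return (x : seq A) := [&& 0 < size x, palindrome (x ++ p),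
  prefix p (x ++ p) & all (fun d => ~~ prefix p (drop d (x ++ p))) (iota 1 (size x).-1)].

Lemma first_return_gap x d : first_return x -> 0 < d < size x ->
  ~~ prefix p (drop d (x ++ p)).
Proof.
case/and4P=> x0 _ _ /allP h d0; apply: h; rewrite mem_iota; lia.
Qed.

Lemma occ_count_first_return x : first_return x -> occ_count p (x ++ p) = 2.
Proof.
move=> fx; have /and4P[x0 _ px _] := fx.
have e : iota 0 (size x).+1 = 0 :: iota 1 (size x).-1 ++ [:: size x].
  have -> : (size x).+1 = 1 + ((size x).-1 + 1) by lia.
  by rewrite 2!iotaD add0n add1n (prednK x0).
rewrite /occ_count size_cat addnK e /= count_cat /= -prefixE drop0 px.
rewrite drop_size_cat // take_size eqxx addn0 -[RHS]/(1 + (0 + 1)); congr (_ + (_ + _)).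
apply/eqP; rewrite -leqn0 leqNgt -has_count; apply/hasPn => d.
by rewrite mem_iota -prefixE => hd; apply: first_return_gap => //; lia.
Qed.

Lemma prefix_flatten_returns s : all first_return s -> prefix p (flatten s ++ p).
Proof.
elim: s => [|x s IH] /=; first by rewrite prefix_refl.
case/andP=> /and4P[_ _ px _] /IH /prefixP[q e].
by rewrite -catA e catA prefix_catl.
Qed.

(** If [x] were shorter than [x'], the [p] that follows [x] would occur in [x' ++ p] at the interior
    offset [size x]. *)
Lemma first_return_inj x x' y y' : first_return x' -> 0 < size x ->
  prefix p y -> prefix p y' -> prefix (x ++ y) (x' ++ y') \/ prefix (x' ++ y') (x ++ y) ->
  size x' <= size x.
Proof.
move=> fx' x0 /prefixP[q ->] /prefixP[q' ->] h; rewrite leqNgt; apply/negP => lx.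
have /negP[] := first_return_gap (d := size x) fx' ltac:(by rewrite x0).
(* The longer of the two compared words extends both [x ++ p] and [x' ++ p]. *)
have [z [e1 e2]] : exists z, prefix (x ++ p) z /\ prefix (x' ++ p) z.
  case: h => h; [exists (x' ++ p ++ q')|exists (x ++ p ++ q)]; split;
    try (by rewrite catA prefix_prefix).
    by apply: prefix_trans h; rewrite catA prefix_prefix.
  by apply: prefix_trans h; rewrite catA prefix_prefix.
have : prefix (x ++ p) (x' ++ p).
  move: e1 e2 => /prefixP[z1 ->] /prefixP[z2 e].
  move: (congr1 (take (size (x ++ p))) e); rewrite take_size_cat // takel_cat; last first.
    by rewrite !size_cat leq_add2r ltnW.
  by move=> ->; rewrite prefix_take.
by case/prefixP=> z3 ->; rewrite -catA drop_size_cat // prefix_prefix.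
Qed.

(** Blocks are read off from the left: the first blocks have equal length by [first_return_inj] used
    both ways, so they coincide and can be cancelled. *)
Lemma flatten_returns_inj s s' y : all first_return s -> all first_return s' ->
  size s = size s' -> prefix (flatten s ++ p) y -> prefix (flatten s' ++ p) y -> s = s'.
Proof.
elim: s s' y => [|x s IH] [|x' s'] //= y /andP[fx fs] /andP[fx' fs'] [es].
rewrite -!catA => h h'.
have [x0 x'0] : 0 < size x /\ 0 < size x'.
  by case/and4P: fx; case/and4P: fx'.
have hc : prefix (x ++ flatten s ++ p) (x' ++ flatten s' ++ p) \/
          prefix (x' ++ flatten s' ++ p) (x ++ flatten s ++ p).
  move: h h'; rewrite !(prefixE _ y) => /eqP <- /eqP <-.
  set a := size _; set b := size _.
  have [ab|/ltnW ba] := leqP a b; [left|right].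
    by rewrite -(minn_idPl ab) take_min prefix_take.
  by rewrite -(minn_idPl ba) take_min prefix_take.
have ex : size x = size x'.
  apply/eqP; rewrite eqn_leq; apply/andP; split.
    by apply: (first_return_inj fx x'0 (prefix_flatten_returns fs') (prefix_flatten_returns fs)); case: hc; [right|left].
  exact: (first_return_inj fx' x0 (prefix_flatten_returns fs) (prefix_flatten_returns fs')).
case/prefixP: h h' => z ->; rewrite -!catA prefix_catr // => /andP[/eqP ->].
move=> h'; congr (_ :: _); apply: IH h' => //.
by rewrite catA prefix_prefix.
Qed.

(** As [x ++ p] and [p] are palindromes, [p ++ rev x = x ++ p], which moves [p] to the right past
    each block. *)
Lemma rev_flatten_returns s : palindrome p -> all first_return s ->
  rev (flatten s ++ p) = flatten (rev s) ++ p.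
Proof.
move=> /palindromeP pp; elim: s => [|x s IH] //= /andP[/and4P[_ /palindromeP px _ _] fs].
rewrite -catA rev_cat IH // rev_cons flatten_rcons -!catA; congr (_ ++ _).
by rewrite -[in RHS]px rev_cat pp.
Qed.

End FirstReturns.

(** * The derived word [v], with [t m] the [m]-th occurrence of [p], counted from zero *)

Section DerivedWord.
Variables (A B : finType) (u : nat -> A) (p : seq A) (t : nat -> nat).
Variables (v : nat -> B) (phi : B -> seq A).
Hypothesis t0 : t 0 = 0.
Hypothesis t_occ : forall m, occurs_at u p (t m).
Hypothesis t_lt : forall m, t m < t m.+1.
Hypothesis t_gap : forall m k, t m < k < t m.+1 -> ~~ occurs_at u p k.
Hypothesis phi_inj : injective phi.
Hypothesis phi_return : forall b, first_return p (phi b).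
Hypothesis phi_v : forall m, phi (v m) = wfactor u (t m) (t m.+1 - t m).

Lemma t_leD m l : t m + l <= t (m + l).
Proof. elim: l => [|l IH]; first by rewrite !addn0. have := t_lt (m + l); rewrite !addnS; lia. Qed.

Lemma t_mono m n : m < n -> t m < t n.
Proof. move=> mn; have := t_leD m (n - m); rewrite subnKC ?(ltnW mn) //; lia. Qed.

Lemma t_surj k : occurs_at u p k -> exists m, k = t m.
Proof.
move=> ok; have [m /andP[mk km]] : exists m, t m <= k < t m.+1.
  elim: k {ok} => [|k [m /andP[mk km]]]; first by exists 0; have := t_lt 0; rewrite t0.
  have [h|h] := ltnP k.+1 (t m.+1); first by exists m; rewrite h leqW.
  by exists m.+1; rewrite h; have := t_lt m.+1; lia.
exists m; move: mk; rewrite leq_eqVlt => /predU1P[-> //|mk].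
by have := t_gap (m := m) (k := k); rewrite mk km ok => /(_ isT).
Qed.

Lemma image_wfactor m l :
  flatten (map phi (wfactor v m l)) = wfactor u (t m) (t (m + l) - t m).
Proof.
elim: l => [|l IH]; first by rewrite addn0 subnn.
have h := t_leD m l; have h' := t_lt (m + l).
rewrite wfactorS map_rcons flatten_rcons IH phi_v -addnS.
have -> : t (m + l.+1) - t m = (t (m + l) - t m) + (t (m + l.+1) - t (m + l)) by rewrite !addnS in h h' *; lia.
by rewrite wfactor_cat subnKC //; lia.
Qed.

Lemma image_wfactor_return m l : flatten (map phi (wfactor v m l)) ++ p =
  wfactor u (t m) (t (m + l) - t m + size p).
Proof.
rewrite image_wfactor wfactor_cat subnKC ?(eqP (t_occ _)) //.
by have := t_leD m l; lia.
Qed.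

Lemma all_phi s : all (first_return p) (map phi s).
Proof. by apply/allP => x /mapP[b _ ->]. Qed.

Lemma phi_decode s s' y : size s = size s' ->
  prefix (flatten (map phi s) ++ p) y -> prefix (flatten (map phi s') ++ p) y -> s = s'.
Proof.
move=> es h h'; apply: (inj_map phi_inj).
by apply: (flatten_returns_inj _ _ _ h h'); rewrite ?all_phi ?size_map.
Qed.

Lemma derived_morph_image : morph_image phi v u.
Proof.
split=> [m s|n].
  by rewrite /s image_wfactor size_wfactor t0 subn0 add0n.
exists n.+1; rewrite image_wfactor size_wfactor t0 subn0.
by have := t_leD 0 n.+1; rewrite t0; lia.
Qed.

Lemma derived_rich :
  palindrome p -> (forall n, size p <= n -> new_pal u n) -> rich v.
Proof.
move=> pal_p hN; apply: new_pal_rich => n n0.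
(* The prefix ends with the occurrence of [p] at [t n]. Since [p] also occurs at [0], the new
   palindrome starts before [t n]. *)
have [||k [kn pk uk]] := @new_pal_extend _ u (t n + size p) 0 (t n) (hN _ (leq_addl _ _)).
- by have := t_mono n0; rewrite t0 leq_addr andbT.
- by left; rewrite addKn -{1}t0 (eqP (t_occ 0)) (eqP (t_occ n)).
(* Reflection carries the final [p] to the start of the palindrome, which is therefore a cut
   point. *)
have [j ek] : exists j, k = t j.
  apply: t_surj; apply/eqP.
  have := palindrome_wfactor_rev pk (n := t n + size p) (k := t n).
  by rewrite addKn (eqP (t_occ n)) (eqP pal_p); apply; lia.
have jn : j < n.
  rewrite ltnNge leq_eqVlt; apply/negP => /predU1P[e|/t_mono]; last by lia.
  by move: kn; rewrite ek e ltnn.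
(* Equal factors of [v] have equal images, so an earlier occurrence in [v] would give an earlier
   occurrence of the palindrome in [u]. *)
have en j' : wfactor v j' (n - j) = wfactor v j (n - j) ->
    wfactor u (t j') (t n + size p - t j) = wfactor u (t j) (t n + size p - t j).
  move=> e; have tjn := t_mono jn.
  have := image_wfactor_return j' (n - j); rewrite e image_wfactor_return => /[dup] e1.
  move/(congr1 size); rewrite !size_wfactor => es; move: e1; rewrite -es subnKC ?(ltnW jn) //.
  by have -> : t n - t j + size p = t n + size p - t j by lia.
exists j; split; first exact: ltnW.
  (* The palindrome of [u] is the image of this factor of [v] followed by [p]; its reversal is the
     image of the reversed factor followed by [p]. Unique decoding identifies the two. *)
  apply/palindromeP; apply: (phi_decode (y := wfactor u k (t n + size p - k))).
  - by rewrite size_rev.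
  - rewrite map_rev -rev_flatten_returns ?all_phi // image_wfactor_return subnKC ?(ltnW jn) //.
    rewrite ek in pk *; have tjn := t_mono jn.
    have -> : t n - t j + size p = t n + size p - t j by lia.
    by rewrite (palindromeP _ pk) prefix_refl.
  rewrite image_wfactor_return subnKC ?(ltnW jn) // ek; have tjn := t_mono jn.
  have -> : t n - t j + size p = t n + size p - t j by lia.
  exact: prefix_refl.
move=> j' j'j /en; rewrite -ek; apply: uk.
by rewrite ek; apply: t_mono.
Qed.

Lemma prefix_wfactor_le i a b : a <= b -> prefix (wfactor u i a) (wfactor u i b).
Proof. by move=> /subnKC <-; rewrite wfactor_cat prefix_prefix. Qed.

(** Every occurrence of [W] in [u] starts with [p], hence at some [t m], and decodes to an
    occurrence of [w] at [m]. The gap bound for [W] serves for [w], since [t] grows by at least one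
    per letter. *)
Lemma derived_uniformly_recurrent : uniformly_recurrent u -> uniformly_recurrent v.
Proof.
move=> ur w [i /eqP ow]; set l := size w in ow.
set W := flatten (map phi w) ++ p.
have [|R hR] := ur W.
  by exists (t i); rewrite /W -ow image_wfactor_return occurs_atE size_wfactor.
exists R => j; have [k /andP[jk kR] oW] := hR (t j).
have [m ek] : exists m, k = t m.
  apply: t_surj; move: oW => /eqP eW.
  have /prefixP[q eq] : prefix p W by apply/prefix_flatten_returns/all_phi.
  by rewrite eq in eW; apply/eqP; exact: wfactor_catl eW.
exists m.
  rewrite ek in jk kR; apply/andP; split.
    by rewrite leqNgt; apply/negP => /t_mono; lia.
  have [mj|/ltnW mj] := leqP m j; first by lia.
  by have := t_leD j (m - j); rewrite subnKC //; lia.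
(* The maximum gives a window at [t m] that has both coded words as prefixes. *)
rewrite occurs_atE; apply/eqP; set L := t (m + size w) - t m + size p.
apply: (phi_decode (y := wfactor u (t m) (maxn L (size W)))).
- by rewrite size_wfactor.
- by rewrite image_wfactor_return prefix_wfactor_le // leq_maxl.
by rewrite -/W -[W in prefix W _](eqP oW) ek prefix_wfactor_le // leq_maxr.
Qed.

End DerivedWord.

(** * Cut points, and the finite alphabet of blocks *)

Lemma occurrences (A : finType) (u : nat -> A) (p : seq A) R : occurs_at u p 0 ->
  (forall j, exists2 k, j <= k <= j + R & occurs_at u p k) ->
  exists t : nat -> nat, [/\ t 0 = 0, forall m, occurs_at u p (t m),
    forall m, t m < t m.+1 <= (t m).+1 + R &
    forall m k, t m < k < t m.+1 -> ~~ occurs_at u p k].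
Proof.
move=> o0 hR; have exS j : exists k, (j < k) && occurs_at u p k.
  by have [k /andP[jk _] ok] := hR j.+1; exists k; rewrite jk.
exists (fun m => iter m (fun j => ex_minn (exS j)) 0); split=> //= [m|m|m k].
- by case: m => [//|m] /=; case: ex_minnP => k /andP[].
(* The search for the next occurrence starts at [j.+1], whence the bound [j.+1 + R]. *)
- set j := iter _ _ _; case: ex_minnP => k /andP[jk _] mk; rewrite jk /=.
  have [k' /andP[jk' kR] ok] := hR j.+1; apply: leq_trans kR; apply: mk.
  by rewrite jk'.
set j := iter _ _ _; case: ex_minnP => k' _ mk /andP[jk kk'].
apply/negP => ok; have := mk k; rewrite jk ok => /(_ isT); lia.
Qed.

Theorem theorem5p5 (A : finType) (u : nat -> A) :
  uniformly_recurrent u -> finite_defect u ->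
  exists (B : finType) (v : nat -> B) (phi : B -> seq A),
    [/\ rich v, class_Pret phi, morph_image phi v u & uniformly_recurrent v].
Proof.
move=> ur /finite_defect_new_pal[N N0 hN].
have [n Nn pal_p] := long_palindromic_prefix ur hN.
(* Since [p] is a prefix of [u], the first cut is at [0] and the blocks cover [u] from its start. *)
set p := wprefix u n in pal_p; have sp : size p = n by rewrite size_wfactor.
have o0 : occurs_at u p 0 by rewrite occurs_atE size_wfactor.
have [R hR] := ur p (ex_intro _ 0 o0).
have [t [t0 t_occ t_lt t_gap]] := occurrences o0 hR.
have lt_t m : t m < t m.+1 by case/andP: (t_lt m).
pose x m := wfactor u (t m) (t m.+1 - t m).
have x_size m : size (x m) <= R.+1.
  by rewrite size_wfactor; have := t_lt m; lia.
have xp m : x m ++ p = wfactor u (t m) (t m.+1 - t m + size p).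
  by rewrite -wfactor_return.
have x_return m : first_return p (x m).
  have tm := lt_t m; apply/and4P; rewrite size_wfactor; split.
  - by rewrite subn_gt0.
  - by rewrite xp; apply: (palindromic_return hN); rewrite ?sp // => k; apply: t_gap.
  - by rewrite -[x m ++ p]drop0 xp prefix_wfactor ?addn0 ?t_occ // add0n leq_addl.
  apply/allP => d; rewrite mem_iota => hd.
  by rewrite xp prefix_wfactor ?leq_add2r; [apply: (t_gap m); lia | lia].
(* Bounded gaps bound the block lengths by [R.+1], so the blocks live in a finite type. [B] takes
   all first returns of such length, whether or not they occur in [u]. *)
pose B : finType := {b : R.+1.-bseq A | first_return p b}.
pose phi (b : B) : seq A := val (val b).
pose v m : B := exist (fun b : R.+1.-bseq A => first_return p b) (Bseq (x_size m)) (x_return m).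
have phi_inj : injective phi by move=> b c /val_inj /val_inj.
have phi_return b : first_return p (phi b) by exact: (valP b).
have phi_v m : phi (v m) = wfactor u (t m) (t m.+1 - t m) by [].
exists B, v, phi; split.
- apply: (derived_rich t0 t_occ lt_t t_gap phi_inj phi_return phi_v pal_p) => k.
  by rewrite sp => /(leq_trans Nn); apply: hN.
- exists p; split=> //; split; first by move=> b; case/and4P: (phi_return b).
  split=> // b; split; last exact: occ_count_first_return.
    by case/and4P: (phi_return b).
  exact: suffix_suffix.
- exact: (derived_morph_image t0 lt_t phi_v).
exact: (derived_uniformly_recurrent t0 t_occ lt_t t_gap phi_inj phi_return phi_v).
Qed.
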